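(* Let $C,D \subseteq \mathbb{R}\setminus\{0\}$ be finite sets and let $\lambda,\mu\in\mathbb{R}$ be fixed. Let $\mathcal{L} \subset \mathrm{Aff}(\mathbb{R})$ be the set of lines \[ \mathcal{L}=\left\{ \big(d(c-\lambda)-\mu,\ c\big) : c\in C,\ d\in D,\ d(c-\lambda)-\mu\neq 0\right\}. \] Then \[ E(\mathcal{L}) \ll |C|^3|D|^{5/2} + |C|^2|D|^3 . \]
   Context: A non-vertical line $y=mx+c$ with $m\neq 0$ is identified with the element $(m,c)$ of the affine group $\mathrm{Aff}(\mathbb{R})=\{(m,c): m\in\mathbb{R}\setminus\{0\}, c\in\mathbb{R}\}$, with multiplication $(a,b)\cdot(c,d)=(ac,ad+b)$ (so $(a,b)^{-1}=(1/a,-b/a)$). For a finite set $\mathcal{L}\subset \mathrm{Aff}(\mathbb{R})$, its energy $E(\mathcal{L})$ is the number of quadruples $(l_1,l_2,l_3,l_4)\in\mathcal{L}^4$ with $l_1^{-1}l_2=l_3^{-1}l_4$. The notation $X\ll Y$ means $X\le cY$ for an absolute constant $c>0$. *)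

(* Defs.v *)
From HB Require Import structures.
From mathcomp Require Import all_boot all_order all_algebra finmap.
From mathcomp Require Import ring.
From mathcomp Require Import reals exp.
Set Implicit Arguments.
Unset Strict Implicit.
Unset Printing Implicit Defensive.
Import Order.TTheory GRing.Theory Num.Theory.
Local Open Scope fset_scope.
Local Open Scope ring_scope.

(* The line y = m * x + c with m != 0 is the element of value (m, c). *)
Record aff (F : fieldType) := Aff { aff_val : F * F; _ : aff_val.1 != 0 }.

HB.instance Definition _ (F : fieldType) := [isSub for @aff_val F].
HB.instance Definition _ (F : fieldType) := [Choice of aff F by <:].

Section AffGroup.
Variable F : fieldType.
Implicit Types u v w : aff F.

Fact aff_mul_subproof u v : ((val u).1 * (val v).1,
  (val u).1 * (val v).2 + (val u).2).1 != 0.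
Proof. by apply: mulf_neq0; [exact: (valP u) | exact: (valP v)]. Qed.

Fact aff_one_subproof : ((1, 0) : F * F).1 != 0.
Proof. exact: oner_neq0. Qed.

Fact aff_inv_subproof u : (1 / (val u).1, - (val u).2 / (val u).1).1 != 0.
Proof. by rewrite /= div1r invr_eq0 (valP u). Qed.

Definition aff_mul u v : aff F := Aff (aff_mul_subproof u v).
Definition aff_one : aff F := Aff aff_one_subproof.
Definition aff_inv u : aff F := Aff (aff_inv_subproof u).

Fact aff_mulA : associative aff_mul.
Proof.
move=> [[a b] /= ha] [[c d] /= hc] [[e f] /= he].
by apply/val_inj; congr pair => /=; ring.
Qed.

Fact aff_mul1 : left_id aff_one aff_mul.
Proof. by move=> [[a b] /= ha]; apply/val_inj; congr pair => /=; ring. Qed.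

Fact aff_mulr1 : right_id aff_one aff_mul.
Proof. by move=> [[a b] /= ha]; apply/val_inj; congr pair => /=; ring. Qed.

Fact aff_mulV : left_inverse aff_one aff_inv aff_mul.
Proof. by move=> [[a b] /= ha]; apply/val_inj; congr pair => /=; field. Qed.

Fact aff_mulrV : right_inverse aff_one aff_inv aff_mul.
Proof. by move=> [[a b] /= ha]; apply/val_inj; congr pair => /=; field. Qed.

HB.instance Definition _ := isGroup.Build (aff F)
  aff_mulA aff_mul1 aff_mulr1 aff_mulV aff_mulrV.

End AffGroup.

Definition energy (G : groupType) (L : {fset G}) : nat :=
  #|` [fset q in (L `*` L) `*` (L `*` L) |
        (q.1.1^-1 * q.1.2 == q.2.1^-1 * q.2.2)%g] |.

(* pmap insub discards the pairs (c, d) for which d * (c - l) - m = 0. *)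
Definition line_set (F : fieldType) (C D : {fset F}) (l m : F) : {fset aff F} :=
  [fset x in pmap (insub : F * F -> option (aff F))
    [seq (d * (c - l) - m, c) | c <- C, d <- D]].

Lemma line_setP (F : fieldType) (C D : {fset F}) (l m : F) (x : aff F) :
  x \in line_set C D l m <->
  exists c d, [/\ c \in C, d \in D, d * (c - l) - m != 0 &
    val x = (d * (c - l) - m, c)].
Proof.
rewrite /line_set inE /= mem_pmap_sub; split.
  case/allpairsP=> -[c d] /= [hc hd e]; exists c, d; split => //.
  by have: (val x).1 != 0 := valP x; rewrite /= e.
by case=> c [d [hc hd _ e]]; apply/allpairsP; exists (c, d).
Qed.

(* Main.v *)
Require Import Defs.
From HB Require Import structures.
From mathcomp Require Import all_boot all_order all_algebra finmap.
From mathcomp Require Import zify ring lra.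
From mathcomp Require Import reals exp.
Set Implicit Arguments.
Unset Strict Implicit.
Unset Printing Implicit Defensive.
Import Order.TTheory GRing.Theory Num.Theory.
Local Open Scope fset_scope.
Local Open Scope ring_scope.

(* The energy is the sum over g of R(g)^2, where R(g) counts the x in L with
   g x in L. Reading off intercepts, R(g) <= |D| N(g), where N(g) counts the
   points of C x C on the graph of the affine map g; also sum R <= (|C||D|)^2.
   If C is cut into r consecutive blocks of size at most s, the graph of a
   monotone map meets fewer than 2r of the r^2 cells of the grid C x C. By
   Cauchy-Schwarz a g with N(g) >= 4r has at least N(g)^2 / 4r ordered pairs of
   distinct points in a common cell, and such a pair determines g, so the sum
   of N(g)^2 over these g is at most 4r (|C| s)^2. The other g contribute at
   most 4r |D| (|C||D|)^2 to the energy. Take s ~ |D|^(1/2), r ~ |C|/s + 1. *)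

(** * Double counting and Cauchy-Schwarz *)

Section Counting.
Local Open Scope nat_scope.

Lemma leq_sum_inj (S T : eqType) (s : seq S) (t : seq T) (P : pred S)
    (Q : pred T) (f : S -> T) :
  uniq s ->
  {in s &, forall x y, P x -> P y -> f x = f y -> x = y} ->
  {in s, forall x, P x -> (f x \in t) && Q (f x)} ->
  \sum_(x <- s) P x <= \sum_(y <- t) Q y.
Proof.
move=> us injf fst.
rewrite -!big_mkcond /= !sum1_count -!size_filter -(size_map f).
apply: uniq_leq_size => [|_ /mapP[x + ->]].
  rewrite map_inj_in_uniq ?filter_uniq // => x y.
  by rewrite !mem_filter => /andP[Px xs] /andP[Py ys]; apply: injf.
by rewrite !mem_filter => /andP[Px /fst/(_ Px)/andP[-> ->]].
Qed.

Lemma sum_fsetM (S T : choiceType) (A : {fset S}) (B : {fset T})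
    (F : S * T -> nat) :
  \sum_(p <- A `*` B) F p = \sum_(a <- A) \sum_(b <- B) F (a, b).
Proof.
rewrite -big_allpairs; apply: perm_big.
apply: uniq_perm; first exact: fset_uniq.
  by apply: allpairs_uniq; rewrite ?fset_uniq // => -[? ?] [? ?].
move=> [a b]; rewrite in_fsetM /=; apply/andP/allpairsP => /= [[]|].
  by exists (a, b).
by case=> -[a' b'] /= [? ? [-> ->]].
Qed.

Lemma card_fset_sum (S : choiceType) (A : {fset S}) (P : pred S) :
  #|` [fset x in A | P x] | = \sum_(x <- A) P x.
Proof.
rewrite -big_mkcond sum1_count -size_filter; apply: perm_size.
apply: uniq_perm; rewrite ?fset_uniq ?filter_uniq ?fset_uniq //.
by move=> x; rewrite mem_filter !inE andbC.
Qed.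

(** Sum [2 * u i * u j <= u i ^ 2 + u j ^ 2] over all pairs of indices. *)
Lemma sqr_sum_le (m : nat) (u : 'I_m -> nat) :
  (\sum_i u i) ^ 2 <= m * \sum_i u i ^ 2.
Proof.
rewrite -(leq_pmul2l (isT : 0 < 2)) -mulnn big_distrlr big_distrr /=.
have -> : 2 * (m * \sum_i u i ^ 2) = \sum_i \sum_j (u i ^ 2 + u j ^ 2).
  under [RHS]eq_bigr do rewrite big_split /= sum_nat_const card_ord.
  by rewrite big_split /= sum_nat_const card_ord -big_distrr /= mul2n addnn.
apply: leq_sum => i _; rewrite big_distrr /=; apply: leq_sum => j _.
by have /leqifP := nat_Cauchy (u i) (u j); case: ifP => _ => [/eqP->|/ltnW].
Qed.

(** Cauchy-Schwarz on the sizes of the [m] label classes: their squares add up to the number of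
    ordered pairs with equal labels, diagonal included. *)
Lemma sqr_count_le_collisions (S : eqType) (s : seq S) (P : pred S) (m : nat)
    (lab : S -> nat) :
  {in s, forall x, P x -> lab x < m} ->
  (\sum_(x <- s) P x) ^ 2 <=
    m * \sum_(x <- s) \sum_(y <- s) [&& P x, P y & lab x == lab y].
Proof.
move=> labm.
have split_lab x : x \in s -> \sum_(i < m) (P x && (lab x == i)) = P x :> nat.
  move=> xs; case Px: (P x) => /=; last by rewrite big1.
  rewrite (bigD1 (Ordinal (labm x xs Px))) //= eqxx big1 // => i.
  by rewrite -val_eqE /= eq_sym => /negPf->.
have -> : \sum_(x <- s) P x
        = \sum_(i < m) \sum_(x <- s) (P x && (lab x == i)).
  by rewrite exchange_big /= !big_seq; apply: eq_bigr => x /split_lab.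
apply: leq_trans (sqr_sum_le _) _; rewrite leq_mul2l; apply/orP; right.
under eq_bigr do rewrite -mulnn big_distrlr /=.
rewrite exchange_big /= big_seq [leqRHS]big_seq; apply: leq_sum => x xs.
rewrite exchange_big /= ; apply: leq_sum => y _.
case Px: (P x) => /=; last by rewrite big1.
rewrite (bigD1 (Ordinal (labm x xs Px))) //= eqxx big1 => [|i].
  by rewrite addn0 mul1n eq_sym.
by rewrite -val_eqE /= eq_sym => /negPf->.
Qed.

End Counting.

(** * Blocks of [C], and graphs of affine maps in the grid [C x C] *)

Section GridCells.
Variables (F : realFieldType) (C : {fset F}).
Local Open Scope nat_scope.

Definition rank (x : F) : nat := count (fun c => c < x)%R C.

Lemma rank_lt_card x : x \in C -> rank x < #|` C|.
Proof.
move=> xC; rewrite ltn_neqAle count_size -all_count andbT.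
by apply/negP => /allP/(_ x xC); rewrite ltxx.
Qed.

Lemma leq_rank x y : (x <= y)%R -> rank x <= rank y.
Proof. by move=> xy; apply: sub_count => c /= cx; apply: lt_le_trans cx xy. Qed.

Lemma ltn_rank x y : x \in C -> (x < y)%R -> rank x < rank y.
Proof.
move=> xC xy.
have := count_predUI (fun c => c < x)%R (pred1 x) C.
have -> : count (predI (fun c => c < x)%R (pred1 x)) C = 0.
  rewrite -(count_pred0 C); apply: eq_count => c /=.
  by case: eqP => [->|]; rewrite ?ltxx ?andbF.
have : 0 < count_mem x C by rewrite -has_count has_pred1.
have : count (predU (fun c => c < x)%R (pred1 x)) C <= rank y.
  apply: sub_count => c /= /orP[cx|/eqP->//]; exact: lt_trans cx xy.
rewrite -/(rank x) => cy c1 cU; apply: leq_trans cy; move: cU.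
by rewrite addn0 => ->; rewrite -addn1 leq_add2l.
Qed.

Lemma rank_inj : {in C &, injective rank}.
Proof.
move=> x y xC yC exy; case: (ltgtP x y) => // xy.
  by have := ltn_rank xC xy; rewrite exy ltnn.
by have := ltn_rank yC xy; rewrite exy ltnn.
Qed.

Definition affapp (g : aff F) (x : F) : F := ((val g).1 * x + (val g).2)%R.

Definition incidences (g : aff F) : nat := \sum_(c <- C) (affapp g c \in C).

Variables (r s : nat).
Hypotheses (s_gt0 : 0 < s) (cardC : #|` C| <= r * s).

Definition block (x : F) : nat := rank x %/ s.

Lemma block_lt x : x \in C -> block x < r.
Proof. by move=> /rank_lt_card xn; rewrite ltn_divLR // (leq_trans xn). Qed.

Lemma leq_block x y : (x <= y)%R -> block x <= block y.
Proof. by move=> /leq_rank; apply: leq_div2r. Qed.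

(** Inside a block the ranks share their quotient by [s], so the remainder alone identifies the
    element. *)
Lemma block_size x : \sum_(y <- C) (block x == block y) <= s.
Proof.
have -> : s = \sum_(j <- iota 0 s) predT j.
  by rewrite sum1_size size_iota.
apply: (leq_sum_inj (f := fun y => rank y %% s)) => [|y z yC zC|y _ _].
- exact: fset_uniq.
- move=> /eqP xy /eqP xz mod_eq; apply: rank_inj => //.
  rewrite (divn_eq (rank y) s) (divn_eq (rank z) s) mod_eq.
  by rewrite -/(block y) -/(block z) -xy -xz.
- by rewrite mem_iota /= ltn_mod s_gt0.
Qed.

(* The cells met by the graph of g form a staircase, so this antidiagonal
   (or diagonal, when g is decreasing) index identifies each of them. *)
Definition cell_label (g : aff F) (x : F) : nat :=
  if (0 < (val g).1)%R then block x + block (affapp g x)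
  else block x + (r - block (affapp g x)).

Lemma cell_label_lt (g : aff F) x :
  x \in C -> affapp g x \in C -> cell_label g x < r.*2.
Proof.
move=> /block_lt xr /block_lt gxr; rewrite /cell_label; case: ifP => _; lia.
Qed.

(** Both terms of the label are nondecreasing in the abscissa, so equal sums force equal terms. For
    negative slope the truncated subtraction loses nothing, since blocks are below [r]. *)
Lemma cell_label_inj (g : aff F) x y :
  affapp g x \in C -> affapp g y \in C -> cell_label g x = cell_label g y ->
  (block x == block y) && (block (affapp g x) == block (affapp g y)).
Proof.
wlog xy : x y / (x <= y)%R => [hw gx gy e|/block_lt gx /block_lt gy].
  case/orP: (le_total x y) => h; first exact: hw.
  by rewrite eq_sym (eq_sym (block (affapp g x))); apply: hw.
have bxy := leq_block xy.
rewrite /cell_label; case: ltP => g0 e.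
  have : block (affapp g x) <= block (affapp g y).
    by apply: leq_block; rewrite lerD2r ler_wpM2l // ltW.
  by move=> ?; apply/andP; split; apply/eqP; lia.
have : block (affapp g y) <= block (affapp g x).
  by apply: leq_block; rewrite lerD2r ler_wnM2l.
by move=> ?; apply/andP; split; apply/eqP; lia.
Qed.

(** The diagonal is excluded because one point does not determine [g]. *)
Definition cell_pair (g : aff F) (x y : F) : bool :=
  [&& x != y, affapp g x \in C, affapp g y \in C, block x == block y &
      block (affapp g x) == block (affapp g y)].

Lemma sqr_incidences_le (g : aff F) : 4 * r <= incidences g ->
  incidences g ^ 2 <= 4 * r * \sum_(x <- C) \sum_(y <- C) cell_pair g x y.
Proof.
move=> rich.
have : incidences g ^ 2 <= r.*2 * \sum_(x <- C)
    \sum_(y <- C) [&& affapp g x \in C, affapp g y \in C &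
                     cell_label g x == cell_label g y].
  apply: sqr_count_le_collisions => x; exact: cell_label_lt.
have : \sum_(x <- C) \sum_(y <- C) [&& affapp g x \in C, affapp g y \in C &
                     cell_label g x == cell_label g y] <=
    incidences g + \sum_(x <- C) \sum_(y <- C) cell_pair g x y.
  rewrite -big_split /= big_seq [leqRHS]big_seq; apply: leq_sum => x xC.
  (* The diagonal terms [y = x] add up to at most [incidences g]. *)
  rewrite (bigD1_seq x) ?fset_uniq //= leq_add ?leq_b1 //.
    by case: (_ \in _) => //=; rewrite leq_b1.
  rewrite big_mkcond; apply: leq_sum => y _.
  case: eqVneq => //= yx; case: and3P => // -[gx gy /eqP e].
  by rewrite /cell_pair eq_sym yx gx gy (cell_label_inj gx gy e).
set A := \sum_(x <- C) _; set B := \sum_(x <- C) _; set N := incidences g.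
(* From [N^2 <= 2r(N + B)] and [4r <= N], the term [2rN] is at most [N^2 / 2], which leaves
   [N^2 <= 4rB]. *)
move=> AB NA; nia.
Qed.

Lemma sum_cell_pair_le (G : {fset aff F}) :
  \sum_(g <- G) \sum_(x <- C) \sum_(y <- C) cell_pair g x y
    <= (#|` C| * s) ^ 2.
Proof.
pose pairs := \sum_(x <- C) \sum_(y <- C) (block x == block y).
have pairs_le : pairs <= #|` C| * s.
  apply: (@leq_trans (\sum_(x <- C) s)).
    by apply: leq_sum => x _; exact: block_size.
  by rewrite big_const_seq count_predT iter_addn addn0 mulnC.
apply: leq_trans (_ : pairs * pairs <= _); last by rewrite -mulnn leq_mul.
rewrite {1}/pairs big_distrl exchange_big /=; apply: leq_sum => x _.
rewrite big_distrl exchange_big /=; apply: leq_sum => y _.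
case bxy: (block x == block y) => /=; last first.
  by rewrite big1 // => g _; rewrite /cell_pair bxy !andbF.
rewrite mul1n /pairs -(sum_fsetM _ _ (fun p => block p.1 == block p.2 : nat)).
(* Two points with distinct abscissae determine g. *)
apply: (leq_sum_inj (f := fun g => (affapp g x, affapp g y))).
- exact: fset_uniq.
- move=> g h _ _ /and5P[xy _ _ _ _] _ [ex ey]; apply/val_inj.
  case: g h ex ey => [[a b] /= ?] [[a' b'] /= ?]; rewrite /affapp /= => ex ey.
  have : ((a - a') * (x - y) = 0)%R.
    transitivity (a * x + b - (a * y + b) - (a' * x + b' - (a' * y + b')))%R.
      by ring.
    by rewrite ex ey subrr.
  move/eqP; rewrite mulf_eq0 !subr_eq0 (negPf xy) orbF => /eqP eaa.
  by move: ex; rewrite eaa => /addrI->.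
- by move=> g _ /and5P[_ gx gy _ e]; rewrite in_fsetM /= gx gy.
Qed.

Lemma sum_rich_incidences (G : {fset aff F}) :
  \sum_(g <- G | 4 * r <= incidences g) incidences g ^ 2
    <= 4 * r * (#|` C| * s) ^ 2.
Proof.
apply: (@leq_trans (\sum_(g <- G | 4 * r <= incidences g)
    4 * r * \sum_(x <- C) \sum_(y <- C) cell_pair g x y)).
  by apply: leq_sum => g; exact: sqr_incidences_le.
rewrite -big_distrr leq_mul2l; apply/orP; right.
apply: leq_trans (sum_cell_pair_le G).
by rewrite big_mkcond; apply: leq_sum => g _; case: ifP.
Qed.

End GridCells.

(** * Energy of lines with intercepts in [C], at most [d] per intercept *)

Section LineFamilies.
Variables (F : realFieldType) (C : {fset F}) (L : {fset aff F}) (d : nat).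
Local Open Scope nat_scope.
Hypothesis intercept_in : {in L, forall x, (val x).2 \in C}.
Hypothesis fiber_le : forall c : F, \sum_(x <- L) ((val x).2 == c) <= d.

Definition translates (g : aff F) : nat := \sum_(x <- L) ((g * x)%g \in L).

Lemma translates_le (g : aff F) : translates g <= d * incidences C g.
Proof.
rewrite /incidences big_distrr /=.
apply: (@leq_trans (\sum_(x <- L) \sum_(c <- C)
    (((val x).2 == c) * (affapp g c \in C)))).
  rewrite /translates big_seq [leqRHS]big_seq; apply: leq_sum => x xL.
  case gx: ((g * x)%g \in L) => //.
  rewrite (bigD1_seq (val x).2) ?fset_uniq ?intercept_in //= eqxx mul1n.
  (* The intercept of [g * x] is the image under [g] of the intercept of [x]. *)
  by have /= -> := intercept_in gx.
rewrite exchange_big; apply: leq_sum => c _.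
by rewrite -big_distrl leq_mul2r fiber_le orbT.
Qed.

Lemma card_lines_le : #|` L| <= #|` C| * d.
Proof.
apply: (@leq_trans (\sum_(x <- L) \sum_(c <- C) ((val x).2 == c))).
  rewrite -sum1_size big_seq [leqRHS]big_seq; apply: leq_sum => x xL.
  by rewrite (bigD1_seq (val x).2) ?fset_uniq ?intercept_in //= eqxx.
rewrite exchange_big; apply: (@leq_trans (\sum_(c <- C) d)).
  by apply: leq_sum => c _.
by rewrite big_const_seq count_predT iter_addn addn0 mulnC.
Qed.

Lemma sum_translates_le (G : {fset aff F}) :
  \sum_(g <- G) translates g <= #|` L| ^ 2.
Proof.
rewrite exchange_big /=; apply: (@leq_trans (\sum_(x <- L) #|` L|)).
  apply: leq_sum => x _.
  have -> : #|` L| = \sum_(y <- L) predT y by rewrite sum1_size.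
  apply: (leq_sum_inj (f := fun g => (g * x)%g)) => [|g h _ _ _ _|g _ ->//].
    exact: fset_uniq.
  exact: mulIg.
by rewrite big_const_seq count_predT iter_addn addn0 -mulnn.
Qed.

(* The relation l1^-1 l2 = l3^-1 l4 says that g = l3 l1^-1 = l4 l2^-1 maps
   l1 and l2 to l3 and l4. *)
Lemma energy_le_sum_translates : exists G : {fset aff F},
  energy L <= \sum_(g <- G) translates g ^ 2.
Proof.
exists [fset (p.2 * p.1^-1)%g | p in L `*` L].
set G := [fset _ | _ in _].
apply: (@leq_trans (\sum_(p <- G `*` (L `*` L))
    (((p.1 * p.2.1)%g \in L) && ((p.1 * p.2.2)%g \in L)))); last first.
  rewrite sum_fsetM; apply: leq_sum => g _; rewrite sum_fsetM.
  rewrite -mulnn big_distrlr /=; apply: leq_sum => x _; apply: leq_sum => y _.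
  by rewrite mulnb.
rewrite /energy card_fset_sum.
have quadE (a b c h : aff F) :
    (a^-1 * b == c^-1 * h)%g -> (c * a^-1 * b = h)%g.
  by move=> /eqP e; rewrite -mulgA e mulVKg.
(* The quadruple is recovered from [(g, (l1, l2))] as [l3 = g l1] and [l4 = g l2]. *)
apply: (leq_sum_inj (f := fun q => ((q.2.1 * q.1.1^-1)%g, (q.1.1, q.1.2)))).
- exact: fset_uniq.
- move=> [[a b] [c h]] [[a' b'] [c' h']] _ _.
  move=> /(quadE a b c h) e /(quadE a' b' c' h') e' /eqP.
  rewrite !xpair_eqE => /and3P[/eqP eg /eqP/= ea /eqP/= eb].
  have hh : h = h' by rewrite -e -e'; congr (_ * _)%g.
  have cc : c = c' by apply: (@mulIg _ a^-1%g); rewrite [LHS]eg ea.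
  by congr (_, _, (_, _)).
- move=> [[a b] [c h]]; rewrite !in_fsetM.
  move=> /andP[/andP[aL bL] /andP[cL hL]] qE.
  apply/andP; split; last first.
    by apply/andP; split; rewrite ?mulgVK // (quadE a b c h qE).
  apply/andP; split; last exact/andP.
  by apply/imfsetP; exists (a, c) => //; rewrite in_fsetM; apply/andP.
Qed.

Lemma energy_le (r s : nat) : 0 < s -> #|` C| <= r * s ->
  energy L <= 4 * r * (#|` C| * d) ^ 2 * (d + s ^ 2).
Proof.
move=> s_gt0 Crs; have [G /leq_trans] := energy_le_sum_translates; apply.
(* The poor [g] give the summand [d], through the sum of [translates]; the rich ones give
   [s ^ 2]. *)
rewrite (bigID (fun g => 4 * r <= incidences C g)) /= addnC mulnDr.
apply: leq_add.
  apply: (@leq_trans (\sum_(g <- G) translates g * (4 * r * d))).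
    rewrite big_mkcond; apply: leq_sum => g _.
    case: (leqP (4 * r)) => //= poor; rewrite -mulnn leq_mul2l.
    rewrite (leq_trans (translates_le g)) ?orbT // mulnC leq_mul2r.
    by rewrite (ltnW poor) orbT.
  rewrite -big_distrl /= [leqRHS]mulnAC [leqRHS]mulnC leq_mul2r.
  apply/orP; right.
  apply: leq_trans (sum_translates_le G) _.
  by rewrite leq_exp2r // card_lines_le.
apply: (@leq_trans (\sum_(g <- G | 4 * r <= incidences C g)
    d ^ 2 * incidences C g ^ 2)).
  by apply: leq_sum => g _; rewrite -expnMn leq_exp2r // translates_le.
rewrite -big_distrr /=.
apply: (@leq_trans (d ^ 2 * (4 * r * (#|` C| * s) ^ 2))).
  by rewrite leq_mul2l (sum_rich_incidences s_gt0 Crs) orbT.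
by rewrite !expnMn; apply: eq_leq; ring.
Qed.

End LineFamilies.

(** * The lines of [line_set] and the choice of parameters *)

Lemma line_set_fiber_le (F : fieldType) (C D : {fset F}) (l m c : F) :
  (\sum_(x <- line_set C D l m) ((val x).2 == c) <= #|` D|)%N.
Proof.
have -> : #|` D| = (\sum_(v <- [seq (e * (c - l) - m)%R | e <- D]) predT v)%N.
  by rewrite sum1_size size_map.
(* Once the intercept is [c], the slope determines the line and comes from an element of [D]. *)
apply: (leq_sum_inj (f := fun x : aff F => (val x).1)).
- exact: fset_uniq.
- move=> x y _ _ /eqP x2 /eqP y2 e1; apply/val_inj.
  by rewrite [LHS]surjective_pairing [RHS]surjective_pairing x2 y2 e1.
- move=> x /line_setP[c' [e [_ eD _ xE]]]; rewrite xE /= andbT => /eqP<-.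
  exact: map_f.
Qed.

Lemma nat_sqrt_exists (n : nat) : exists s : nat, (s ^ 2 <= n < s.+1 ^ 2)%N.
Proof.
elim: n => [|n [s /andP[sn ns]]]; first by exists 0%N.
case: (leqP (s.+1 ^ 2) n.+1) => h; last by exists s; rewrite h (leq_trans sn).
by exists s.+1; rewrite h; move: ns; rewrite -!mulnn; lia.
Qed.

Lemma powR_five_halves (R : realType) (x : R) : 0 <= x ->
  x `^ (5 / 2) = x ^+ 2 * Num.sqrt x.
Proof.
move=> x_ge0; have -> : 5 / 2 = 2%:R + 2^-1 :> R by field.
rewrite powRD; last by rewrite gt_eqF ?implybT //; lra.
by rewrite powR_mulrn // powR12_sqrt.
Qed.

Theorem theorem3 (R : realType) :
  exists K : R, 0 < K /\
    forall (C D : {fset R}) (lambda mu : R),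
      0 \notin C -> 0 \notin D ->
      (energy (line_set C D lambda mu))%:R <=
        K * ((#|` C|%:R) ^+ 3 * (#|` D|%:R) `^ (5 / 2)
             + (#|` C|%:R) ^+ 2 * (#|` D|%:R) ^+ 3).
Proof.
exists 16; split=> // C D lambda mu _ _.
set n := #|` C|; set d := #|` D|.
have energy_bound r s : (0 < s)%N -> (n <= r * s)%N ->
    (energy (line_set C D lambda mu) <= 4 * r * (n * d) ^ 2 * (d + s ^ 2))%N.
  apply: energy_le => [x /line_setP[c [e [cC _ _ ->]]] //|c].
  exact: line_set_fiber_le.
(* Empty [D] is set apart: the integer square root of [d] would be 0, not a valid block size. *)
have [d0|d_gt0] := posnP d.
  have := energy_bound n 1%N isT; rewrite muln1 d0 muln0 exp0n // muln0 mul0n.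
  rewrite leqn0 => /(_ (leqnn _))/eqP->.
  by rewrite mulr_ge0 ?addr_ge0 ?mulr_ge0 ?exprn_ge0 ?powR_ge0.
have [s /andP[sd ds]] := nat_sqrt_exists d.
have s_gt0 : (0 < s)%N by case: s ds {sd} => //; rewrite exp1n ltnS leqNgt d_gt0.
(* The number of blocks is [r = n %/ s + 1], so that [n <= r * s <= n + s]. *)
have n_le : (n <= (n %/ s).+1 * s)%N by rewrite ltnW // ltn_ceil.
have rs_le : ((n %/ s).+1 * s <= n + s)%N.
  by rewrite mulSn addnC leq_add2r leq_trunc_div.
apply: le_trans (_ : _ <= (4 * (n %/ s).+1 * (n * d) ^ 2 * (d + s ^ 2))%:R) _.
  by rewrite ler_nat energy_bound.
rewrite powR_five_halves //; move: (n %/ s).+1 rs_le => r rs_le.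
have [n_ge0 d_ge0] := (ler0n R n, ler0n R d); have r_ge0 := ler0n R r.
have qE : Num.sqrt d%:R * Num.sqrt d%:R = d%:R :> R by rewrite -expr2 sqr_sqrtr.
have q_ge0 := sqrtr_ge0 (d%:R : R).
have s_ge1 : 1 <= s%:R :> R by rewrite ler1n.
have s_le_q : s%:R <= Num.sqrt d%:R :> R.
  by rewrite -ler_sqr ?nnegrE // sqr_sqrtr // -natrX ler_nat.
(* The root is below [s + 1], which is at most [2 * s] as [s >= 1]. *)
have q_le_s : Num.sqrt d%:R <= 2 * s%:R :> R.
  apply: (@le_trans _ _ (s.+1%:R)); last by rewrite -natr1; lra.
  by rewrite -ler_sqr ?nnegrE // sqr_sqrtr // -natrX ler_nat ltnW.
have rs_leR : r%:R * s%:R <= n%:R + s%:R :> R by rewrite -natrM -natrD ler_nat.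
have sd_leR : s%:R ^+ 2 <= d%:R :> R by rewrite -natrX ler_nat.
rewrite !(natrM, natrD, natrX).
move: (n%:R : R) (d%:R : R) (Num.sqrt _) (r%:R : R) (s%:R : R) n_ge0 d_ge0 r_ge0
  qE q_ge0 s_ge1 s_le_q q_le_s rs_leR sd_leR => a x q t u.
move=> a_ge0 x_ge0 t_ge0 qE q_ge0 u_ge1 u_le_q q_le_u tu_le u2_le.
have tq_le : t * q <= 2 * (a + u) by nra.
(* Write [x = q * q], multiply [tq_le] by [q], and use [u <= q]. *)
have tx_le : t * x <= 2 * (a * q + x).
  rewrite -qE mulrA; apply: le_trans (ler_wpM2r q_ge0 tq_le) _; nra.
(* Since [u ^+ 2 <= x], the bound becomes [8 * (a * x) ^+ 2 * (t * x)]; the factor 2 in [tx_le] then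
   gives 16. *)
apply: (@le_trans _ _ (4 * t * (a * x) ^+ 2 * (x + x))).
  by rewrite ler_wpM2l ?lerD2l // !mulr_ge0 ?exprn_ge0 ?mulr_ge0.
rewrite (_ : _ * (x + x) = 8 * (a * x) ^+ 2 * (t * x)); last by ring.
rewrite (_ : 16 * _ = 8 * (a * x) ^+ 2 * (2 * (a * q + x))); last by ring.
by rewrite ler_wpM2l // mulr_ge0 ?exprn_ge0 ?mulr_ge0.
Qed.
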